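(* Let $\lambda$ be a nonzero real number. For integers $n\ge 0$ let $(x)_{0,\mu}=1$ and $(x)_{n,\mu}=x(x-\mu)\cdots(x-(n-1)\mu)$ for $n\ge1$, for any nonzero parameter $\mu$. Define the degenerate Eulerian polynomials with parameter $\mu$ by $\sum_{j=0}^{\infty}(j+1)_{n,\mu}x^{j}=\frac{A_{n,\mu}(x)}{(1-x)^{n+1}}$ for $|x|<1$, and the degenerate Eulerian numbers by $A_{n,\mu}(x)=\sum_{k=0}^{n}A_{\mu}(n,k)x^{k}$. Then for all positive integers $m,n$, \[\sum_{k=1}^{m}(k)_{n,\lambda}=\sum_{j=0}^{n}A_{-\lambda}(n,j)\binom{m+j+1}{n+1}.\]
   Context: $A_{-\lambda}(n,j)$ is the degenerate Eulerian number with parameter $\mu=-\lambda$. *)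

(* Defs.v *)
From HB Require Import structures.
From mathcomp Require Import all_boot all_order all_algebra.
From mathcomp Require Import all_classical all_reals all_analysis.

Set Implicit Arguments.
Unset Strict Implicit.
Unset Printing Implicit Defensive.

Import Order.TTheory GRing.Theory Num.Theory.
Import numFieldNormedType.Exports.

Local Open Scope classical_set_scope.
Local Open Scope ring_scope.

(* (x)_{n,mu} = x (x - mu) ... (x - (n-1) mu), with (x)_{0,mu} = 1. *)
Definition degenerate_ffact (R : realType) (mu : R) (n : nat) (x : R) : R :=
  \prod_(i < n) (x - i%:R * mu).

(* The degree bound [size A <= n.+1] is the requirement that A be of the form
   \sum_(0 <= k <= n) A_mu(n,k) x^k. *)
Definition is_degenerate_Eulerian_poly (R : realType) (mu : R) (n : nat)
    (A : {poly R}) : Prop :=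
  (size A <= n.+1)%N /\
  forall x : R, `|x| < 1 ->
    series (fun j : nat => degenerate_ffact mu n j.+1%:R * x ^+ j) @ \oo
      --> A.[x] / (1 - x) ^+ n.+1.

(* The polynomial characterized by the generating function. It is unique, since
   two candidates agree on ]-1, 1[, and it exists because j |-> (j+1)_{n,mu} is
   polynomial of degree n in j; the default value 0 is therefore never used. *)
Definition degenerate_Eulerian_poly (R : realType) (mu : R) (n : nat)
    : {poly R} :=
  xget 0 [set A : {poly R} | is_degenerate_Eulerian_poly mu n A].

Definition degenerate_Eulerian_number (R : realType) (mu : R) (n k : nat) : R :=
  (degenerate_Eulerian_poly mu n)`_k.

(* Main.v *)
(* Write a_k = A_mu(n, k) with mu = - lambda. The generating function together
   with \sum_j 'C(j + n - k, n) x^j = x^k / (1 - x)^(n+1), k <= n, amounts to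
   (t)_{n,mu} = \sum_k a_k 'C(t + n - k - 1, n) for t >= 1. This is a polynomial
   identity in t, and substituting - t for t turns it into
   (t)_{n,lambda} = \sum_k a_k 'C(t + k, n). Since (0)_{n,lambda} = 0 for n > 0,
   summing over 0 <= t <= m with the hockey-stick identity gives the result.
   Both expansions follow by induction on n from a common recurrence for a_k. *)
Require Import Defs.
From HB Require Import structures.
From mathcomp Require Import all_boot all_order all_algebra.
From mathcomp Require Import all_classical all_reals all_analysis.
From mathcomp Require Import ring lra zify.

Set Implicit Arguments.
Unset Strict Implicit.
Unset Printing Implicit Defensive.

Import Order.TTheory GRing.Theory Num.Theory.
Import numFieldNormedType.Exports.

Local Open Scope ring_scope.

(** For N < n the factor N - n is negative in [R] where [mul_bin_left] truncates it to 0, but both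
    binomials vanish there. *)
Lemma natr_mul_binS (R : pzRingType) (N n : nat) :
  n.+1%:R * 'C(N, n.+1)%:R = (N%:R - n%:R) * 'C(N, n)%:R :> R.
Proof.
rewrite -natrM mul_bin_left.
have [leN|ltN] := leqP n N; first by rewrite natrM natrB.
by rewrite bin_small // !(muln0, mulr0).
Qed.

Lemma natr_mul_binSS (R : pzRingType) (N n : nat) :
  n.+1%:R * 'C(N.+1, n.+1)%:R = N.+1%:R * 'C(N, n)%:R :> R.
Proof. by rewrite -!natrM -mul_bin_diag. Qed.

(** Hockey-stick identity. Since k <= n, the missing terms 'C(i, n) with i < k are all zero, so
    nothing is lost by starting at 'C(k, n). *)
Lemma sum_binS_upper (n k m : nat) :
  (k <= n)%N -> (\sum_(t < m.+1) 'C(t + k, n) = 'C(m + k + 1, n.+1))%N.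
Proof.
move=> lekn; elim: m => [|m IH]; last first.
  by rewrite big_ord_recr IH /= !addn1 !addSn binS.
by rewrite big_ord1 !add0n addn1 binS [X in _ = (X + _)%N]bin_small.
Qed.

Section EulerianCoefficients.
Variables (R : realType) (mu : R).

(* The recurrence comes from expanding [(j + 1 - n mu) 'C(j + n - k, n)] in
   ['C(j + n + 1 - k, n + 1)] and ['C(j + n - k, n + 1)]. *)
Fixpoint eulerian_coef (n k : nat) : R :=
  if n is n'.+1 then
    (if (k <= n')%N then eulerian_coef n' k * (1 - n'%:R * mu + k%:R) else 0) +
    (if k is k'.+1 then eulerian_coef n' k' * (n'%:R - k'%:R + n'%:R * mu)
     else 0)
  else (k == 0)%:R.

(** Moves the recurrence from the coefficients to the weights, so that both binomial expansions
    below can be checked term by term. *)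
Lemma sum_eulerian_coefS (n : nat) (w : nat -> R) :
  \sum_(k < n.+2) eulerian_coef n.+1 k * w k =
  \sum_(k < n.+1) eulerian_coef n k *
    ((1 - n%:R * mu + k%:R) * w k + (n%:R - k%:R + n%:R * mu) * w k.+1).
Proof.
under eq_bigr do rewrite /= mulrDl.
rewrite big_split /= big_ord_recr [X in _ + X]big_ord_recl /= ltnn !mul0r addr0 add0r.
rewrite -big_split /=; apply: eq_bigr => k _.
by rewrite -ltnS ltn_ord /bump /= add1n; ring.
Qed.

Lemma degenerate_ffactS (nu : R) (n : nat) (x : R) :
  degenerate_ffact nu n.+1 x = degenerate_ffact nu n x * (x - n%:R * nu).
Proof. by rewrite /degenerate_ffact big_ord_recr. Qed.

Lemma degenerate_ffact_eulerian (n j : nat) :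
  degenerate_ffact mu n j.+1%:R =
  \sum_(k < n.+1) eulerian_coef n k * 'C(j + (n - k), n)%:R.
Proof.
elim: n => [|n IH].
  by rewrite /degenerate_ffact big_ord0 big_ord1 /= bin0 mulr1.
rewrite degenerate_ffactS IH (sum_eulerian_coefS n (fun k => 'C(j + (n.+1 - k), n.+1)%:R)).
rewrite mulr_suml; apply: eq_bigr => k _.
have lekn : (k <= n)%N by rewrite -ltnS.
rewrite -mulrA; congr (_ * _); rewrite subSS subSn // addnS.
have nz : n.+1%:R != 0 :> R by rewrite pnatr_eq0.
(* Times n + 1, both binomials become multiples of 'C(j + (n - k), n), leaving a polynomial identity
   in j, k, n and [mu]. *)
apply: (mulfI nz); rewrite [RHS]mulrDr !(mulrCA n.+1%:R) natr_mul_binSS natr_mul_binS.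
rewrite -!natr1 natrD natrB //; ring.
Qed.

(* The same coefficients, by the reflection
   [(t)_{n,-mu} = (-1)^n (-t)_{n,mu}]. *)
Lemma degenerate_ffactN_eulerian (n t : nat) :
  degenerate_ffact (- mu) n t%:R =
  \sum_(k < n.+1) eulerian_coef n k * 'C(t + k, n)%:R.
Proof.
elim: n => [|n IH].
  by rewrite /degenerate_ffact big_ord0 big_ord1 /= bin0 mulr1.
rewrite degenerate_ffactS IH (sum_eulerian_coefS n (fun k => 'C(t + k, n.+1)%:R)).
rewrite mulr_suml; apply: eq_bigr => k _.
rewrite -mulrA; congr (_ * _); rewrite addnS.
have nz : n.+1%:R != 0 :> R by rewrite pnatr_eq0.
apply: (mulfI nz); rewrite [RHS]mulrDr !(mulrCA n.+1%:R) natr_mul_binSS natr_mul_binS.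
rewrite -!natr1 natrD; ring.
Qed.

End EulerianCoefficients.

Section BinomialSeries.
Variable R : realType.

(** Multiplying by 1 - x takes differences of consecutive coefficients, which Pascal's rule
    evaluates; the subtracted term is the cost of truncating at N. *)
Lemma bin_series_partialS (n N : nat) (x : R) :
  (1 - x) * \sum_(0 <= j < N) 'C(j + n.+1, n.+1)%:R * x ^+ j =
  \sum_(0 <= j < N) 'C(j + n, n)%:R * x ^+ j - 'C(N + n, n.+1)%:R * x ^+ N.
Proof.
elim: N => [|N IH]; first by rewrite !big_geq // bin_small // mulr0 mul0r subr0.
rewrite !big_nat_recr //= mulrDr IH addnS addSn binS natrD exprS; ring.
Qed.

Lemma bin_series_partial_le (n N : nat) (y : R) : 0 <= y < 1 ->
  \sum_(0 <= j < N) 'C(j + n, n)%:R * y ^+ j <= (1 - y) ^- n.+1.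
Proof.
move=> /andP[y0 y1]; have y1' : 0 < 1 - y by rewrite subr_gt0.
elim: n => [|n IH].
  rewrite expr1 -[leRHS]div1r ler_pdivlMr //.
  elim: N => [|N IH]; first by rewrite big_geq // mul0r.
  have -> : (\sum_(0 <= j < N.+1) 'C(j + 0, 0)%:R * y ^+ j) * (1 - y) = 1 - y ^+ N.+1.
    elim: N.+1 => [|M IHM]; first by rewrite big_geq // mul0r subrr.
    by rewrite big_nat_recr //= mulrDl IHM bin0 exprS; ring.
  by rewrite gerBl exprn_ge0.
rewrite exprS invfM -ler_pdivrMl ?invr_gt0 // invrK bin_series_partialS.
by apply: le_trans IH; rewrite gerBl mulr_ge0 // exprn_ge0.
Qed.

(* For [|x| < y < 1] the terms of the series at [y] are bounded by its partial
   sums, so the terms at [x] are at most [(1 - y)^-(n+1) (|x|/y)^N]. *)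
Lemma cvg_bin_expr (n : nat) (x : R) : `|x| < 1 ->
  ((fun N => 'C(N + n, n)%:R * x ^+ N : R) @ \oo --> (0 : R))%classic.
Proof.
move=> x1; pose y := (1 + `|x|) / 2.
have x0 := normr_ge0 x.
have y0 : 0 < y by rewrite /y; lra.
have y1 : y < 1 by rewrite /y; lra.
have xy : `|x| < y by rewrite /y; lra.
apply/cvgr0Pnorm_lt => e e0; pose K := (1 - y) ^- n.+1.
have K0 : 0 < K by rewrite invr_gt0 exprn_gt0 // subr_gt0.
have q1 : `| `|x| / y| < 1.
  by rewrite ger0_norm ?divr_ge0 ?(ltW y0) // ltr_pdivrMr // mul1r.
have /cvgr0_norm_lt /(_ (e / K)) := cvg_expr q1.
rewrite divr_gt0 // => /(_ isT).
apply: filterS => N.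
rewrite ger0_norm ?exprn_ge0 ?divr_ge0 ?(ltW y0) // ltr_pdivlMr // => HN.
apply: le_lt_trans HN.
rewrite normrM normr_nat normrX exprMn mulrC -mulrA ler_wpM2l ?exprn_ge0 //.
rewrite exprVn mulrC ler_pdivlMr ?exprn_gt0 //.
apply: le_trans (bin_series_partial_le n N.+1 _); last by rewrite (ltW y0).
rewrite big_nat_recr //= lerDr sumr_ge0 // => j _.
by rewrite mulr_ge0 // exprn_ge0 // ltW.
Qed.

Lemma cvg_bin_series (n : nat) (x : R) : `|x| < 1 ->
  (series (fun j => 'C(j + n, n)%:R * x ^+ j : R) @ \oo
    --> (1 - x) ^- n.+1)%classic.
Proof.
move=> x1; have nz : 1 - x != 0.
  by rewrite subr_eq0 eq_sym; apply: contraTneq x1 => ->; rewrite normr1 ltxx.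
elim: n => [|n IH].
  have := @cvg_geometric_series R 1 x x1; rewrite expr1 mul1r.
  apply: cvg_trans; apply: near_eq_cvg; near=> N.
  by rewrite /series /=; apply: eq_bigr => j _; rewrite bin0.
have cN : ((fun N => 'C(N + n, n.+1)%:R * x ^+ N : R) @ \oo --> (0 : R))%classic.
  (* At N + 1 the truncation term is x times the sequence of [cvg_bin_expr] for n + 1. *)
  rewrite -(mulr0 x) -cvg_shiftS.
  apply: cvg_trans (cvgMl_tmp (cvg_bin_expr n.+1 x1)).
  apply: near_eq_cvg; near=> N.
  by rewrite /= mulrCA -exprS -addSnnS.
rewrite exprS invfM -[X in _ * X]subr0.
apply: cvg_trans (cvgMl_tmp (cvgB IH cN)); apply: near_eq_cvg; near=> N.
rewrite /series /=; apply: (mulfI nz).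
by rewrite bin_series_partialS mulVKf.
Unshelve. all: by end_near. Qed.

(** Raising k by one multiplies the series by x: as long as k < n, the new constant coefficient 'C(n
    - (k + 1), n) is zero. *)
Lemma cvg_bin_series_shift (n k : nat) (x : R) : (k <= n)%N -> `|x| < 1 ->
  (series (fun j => 'C(j + (n - k), n)%:R * x ^+ j : R) @ \oo
    --> x ^+ k / (1 - x) ^+ n.+1)%classic.
Proof.
move=> lekn x1; elim: k lekn => [|k IH] lekn.
  by rewrite subn0 mul1r; exact: cvg_bin_series.
rewrite exprS -mulrA -cvg_shiftS.
apply: cvg_trans (cvgMl_tmp (IH (ltnW lekn))); apply: near_eq_cvg; near=> N.
rewrite /series /= big_nat_recl // add0n bin_small; last by lia.
rewrite mul0r add0r mulr_sumr; apply: eq_bigr => j _.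
by rewrite mulrCA -exprS addSnnS -subSn.
Unshelve. all: by end_near. Qed.

End BinomialSeries.

Lemma is_degenerate_Eulerian_poly_coef (R : realType) (mu : R) (n : nat) :
  is_degenerate_Eulerian_poly mu n (\poly_(k < n.+1) eulerian_coef mu n k).
Proof.
split=> [|x x1]; first exact: size_poly.
rewrite horner_poly mulr_suml.
(* Each partial sum is a fixed finite combination of those of the shifted binomial series, so limits
   can be taken for each k separately. *)
have -> : series (fun j => degenerate_ffact mu n j.+1%:R * x ^+ j) =
  \sum_(k < n.+1) (fun N => eulerian_coef mu n k *
     series (fun j => 'C(j + (n - k), n)%:R * x ^+ j) N).
  apply/funext => N; rewrite fct_sumE /series /=.
  under [RHS]eq_bigr do rewrite mulr_sumr.
  rewrite exchange_big /=; apply: eq_bigr => j _.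
  rewrite degenerate_ffact_eulerian mulr_suml.
  by apply: eq_bigr => k _; rewrite mulrA.
rewrite fct_sumE; apply: cvg_big => [|k _]; first exact: add_continuous.
rewrite -mulrA; apply: cvgMl_tmp.
by apply: cvg_bin_series_shift => //; rewrite -ltnS.
Qed.

Lemma is_degenerate_Eulerian_poly_unique (R : realType) (mu : R) (n : nat)
    (A B : {poly R}) :
  is_degenerate_Eulerian_poly mu n A -> is_degenerate_Eulerian_poly mu n B ->
  A = B.
Proof.
move=> [_ hA] [_ hB]; apply/eqP; rewrite -subr_eq0; apply/negPn/negP => nz.
(* The points 1/(i + 2) are distinct and lie in ]0, 1[; there are [size (A - B)] of them, one more
   root than a nonzero [A - B] can have. *)
pose s : seq R := [seq i.+2%:R^-1 | i <- iota 0 (size (A - B))].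
have us : uniq s.
  rewrite map_inj_uniq ?iota_uniq // => i j /invr_inj /eqP.
  by rewrite eqr_nat => /eqP[].
have rs : all (root (A - B)) s.
  apply/allP => _ /mapP[i _ ->]; set x : R := _^-1.
  have x0 : 0 < x by rewrite invr_gt0.
  have x1 : x < 1 by rewrite invf_lt1 ?ltr1n.
  have nx : `|x| < 1 by rewrite gtr0_norm.
  have nz1 : (1 - x) ^+ n.+1 != 0 by rewrite expf_neq0 // subr_eq0 gt_eqF.
  rewrite rootE hornerD hornerN subr_eq0; apply/eqP/(divIf nz1).
  exact: norm_cvg_unique (hA x nx) (hB x nx).
by have := max_poly_roots nz rs us; rewrite size_map size_iota ltnn.
Qed.

(** Existence makes [xget] return a genuine solution, and uniqueness identifies it with the explicit
    polynomial. *)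
Lemma degenerate_Eulerian_numberE (R : realType) (mu : R) (n k : nat) :
  (k <= n)%N -> degenerate_Eulerian_number mu n k = eulerian_coef mu n k.
Proof.
move=> lekn; have ex := is_degenerate_Eulerian_poly_coef mu n.
have -> : degenerate_Eulerian_number mu n k =
    (\poly_(i < n.+1) eulerian_coef mu n i)`_k.
  congr (nth 0 (polyseq _) k); apply: is_degenerate_Eulerian_poly_unique (ex).
  exact: (xgetI 0 ex).
by rewrite coef_poly ltnS lekn.
Qed.

Theorem theorem2p9 (R : realType) (lambda : R) (hlambda : lambda != 0)
    (m n : nat) (hm : (0 < m)%N) (hn : (0 < n)%N) :
  \sum_(1 <= k < m.+1) degenerate_ffact lambda n k%:R =
  \sum_(0 <= j < n.+1)
    degenerate_Eulerian_number (- lambda) n j * 'C(m + j + 1, n + 1)%:R.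
Proof.
have ffact0 : degenerate_ffact lambda n 0%:R = 0.
  by case: n hn => // n _; rewrite /degenerate_ffact big_ord_recl /= mul0r subrr mul0r.
transitivity (\sum_(0 <= k < m.+1) degenerate_ffact lambda n k%:R).
  by rewrite [RHS]big_nat_recl // ffact0 add0r big_add1.
(* Reading [lambda] as [- (- lambda)] on the left makes the reflected expansion apply with
   [mu := - lambda]. *)
rewrite !big_mkord -{1}[lambda]opprK.
under eq_bigr do rewrite degenerate_ffactN_eulerian.
rewrite exchange_big /=; apply: eq_bigr => k _.
have lekn : (k <= n)%N by rewrite -ltnS.
by rewrite degenerate_Eulerian_numberE // -mulr_sumr -natr_sum sum_binS_upper // (addn1 n).
Qed.
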